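(* For $k\in\mathbb{N}$ let $c_k=\dfrac{3\,|B_{2k}|\,(2^{2k}-2)+(-1)^{k}}{(2k)!}$, where $B_{2k}$ denotes the Bernoulli number. For every $x\in(0,\pi/2)$ and every integer $m\ge 3$, $$4+\sum_{k=1}^{m-1}c_k x^{2k}+\Big(\frac{2x}{\pi}\Big)^{2m}\Big(\frac{3\pi}{2}-4-\sum_{k=1}^{m-1}c_k\Big(\frac{\pi}{2}\Big)^{2k}\Big)>3\,\frac{x}{\sin x}+\cos x>4+\sum_{k=1}^{m}c_k x^{2k}.$$
   Context: $B_j$ are the Bernoulli numbers ($B_2=1/6$, $B_4=-1/30$, $B_6=1/42,\dots$). The quantity $3\pi/2$ is the value at $x=\pi/2$ of $3x/\sin x+\cos x$. *)

(* Defs.v *)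
From Stdlib Require Import Arith Reals Lra Lia List.
Open Scope R_scope.

(* Bernoulli numbers via the standard recursion
   B_0 = 1,  B_n = -1/(n+1) * sum_{k=0}^{n-1} C(n+1,k) B_k  (so B_1 = -1/2).
   bern_upto n is the list [B_0; ...; B_n]. *)
Fixpoint bern_upto (n : nat) : list R :=
  match n with
  | O => 1 :: nil
  | S n' =>
      let l := bern_upto n' in
      l ++ (- / (INR n + 1) *
              sum_f_R0 (fun k => C (S n) k * nth k l 0) n') :: nil
  end.

Definition bernoulli (n : nat) : R := nth n (bern_upto n) 0.

Definition c (k : nat) : R :=
  (3 * Rabs (bernoulli (2 * k)) * (2 ^ (2 * k) - 2) + (-1) ^ k)
  / INR (fact (2 * k)).

Fixpoint csum (n : nat) (x : R) : R :=
  match n with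
  | O => 0
  | S n' => csum n' x + c n * x ^ (2 * n)
  end.

(* Main.v *)
(** With [G(t) = sum B_n t^n / n!], the Bernoulli recursion says
    [G(t) (e^t - 1) = t].  Differentiating, [H = G + t/2] satisfies the Riccati
    equation [t H' = H - H^2 + t^2/4], so [H] is even, and the numbers
    [b_k = (-1)^(k-1) 4^k B_{2k} / (2k)!] satisfy
    [(2k+1) b_k = sum_{0<i<k} b_i b_{k-i}] for [k >= 2], with [b_1 = 1/3].  Hence
    [0 < b_k <= 2 / 6^k], and [1 - sum b_k x^(2k)] converges for [x^2 < 6], where
    it equals [x cot x] because both solve the same Riccati equation.  From
    [1 / sin x = cot (x/2) - cot x] one gets
    [3 x / sin x + cos x = 4 + sum c_k x^(2k)] on [(0, pi/2]].  The recursion also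
    gives [3/2 b_k >= 1 / (2k)!] for [k >= 3], so [c_k > 0] there: the lower bound
    drops a positive tail, and the upper bound holds because the tail divided by
    [x^(2m)] is strictly increasing. *)

Require Import Defs.
From Stdlib Require Import Arith Reals Lra Lia List.
From Coquelicot Require Import Coquelicot.
Open Scope R_scope.

(** * Power series *)

Lemma CV_radius_gt_of_bound (a : nat -> R) (r M x : R) :
  (forall n, Rabs (a n * r ^ n) <= M) -> Rabs x < r ->
  Rbar_lt (Rabs x) (CV_radius a).
Proof.
intros Ha Hx.
apply Rbar_lt_le_trans with (Finite r); [exact Hx|].
apply (proj1 (CV_radius_bounded a)).
now exists M.
Qed.

(** Beyond the radius of convergence the terms do not tend to 0, which convergence at [x]
    forbids. *)
Lemma CV_radius_ge_of_ex_pseries (a : nat -> R) (x : R) :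
  ex_pseries a x -> Rbar_le (Rabs x) (CV_radius a).
Proof.
intros H.
destruct (Rbar_le_lt_dec (Rabs x) (CV_radius a)) as [|Hlt]; [assumption|].
exfalso; apply (CV_disk_outside a x Hlt).
apply ex_series_lim_0, (proj1 (ex_pseries_R a x)), H.
Qed.

Lemma CV_radius_gt_0_of_ex_pseries (a : nat -> R) (x : R) :
  0 < x -> ex_pseries a x -> Rbar_lt 0 (CV_radius a).
Proof.
intros Hx H.
apply Rbar_lt_le_trans with (Finite (Rabs x)).
- simpl; rewrite Rabs_pos_eq; lra.
- now apply CV_radius_ge_of_ex_pseries.
Qed.

(** Isolates the two end terms of the Cauchy square, the only ones containing [a (S (S n))], so that
    a quadratic recursion can be solved for its newest coefficient. *)
Lemma PS_mult_self_SS (a : nat -> R) (n : nat) :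
  PS_mult a a (S (S n))
  = 2 * a 0%nat * a (S (S n)) + PS_mult (PS_decr_1 a) (PS_decr_1 a) n.
Proof.
unfold PS_mult.
rewrite decomp_sum by lia; simpl pred.
rewrite tech5.
replace (S (S n) - 0)%nat with (S (S n)) by lia.
replace (S (S n) - S (S n))%nat with 0%nat by lia.
replace (sum_f_R0 (fun i => a (S i) * a (S (S n) - S i)%nat) n)
  with (sum_f_R0 (fun k => PS_decr_1 a k * PS_decr_1 a (n - k)%nat) n).
2:{ apply sum_eq; intros i Hi; unfold PS_decr_1.
    now replace (S (S n) - S i)%nat with (S (n - i)) by lia. }
ring.
Qed.

Definition PS_one (n : nat) : R := match n with O => 1 | S _ => 0 end.

Lemma is_pseries_one (x : R) : is_pseries PS_one x 1.
Proof.
apply is_pseries_R, (is_series_decr_1 (V := R_NormedModule)).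
apply (is_series_ext (V := R_NormedModule) (fun _ => 0)).
- intros n; simpl; ring.
- replace (plus 1 _) with 0.
  + apply is_series_Reals; intros e He; exists 0%nat; intros n _.
    rewrite sum_eq_R0 by reflexivity.
    now rewrite R_dist_eq.
  + unfold plus, opp; simpl; ring.
Qed.

Lemma sum_f_R0_even (f : nat -> R) (n : nat) :
  (forall k, f (S (2 * k)) = 0) ->
  sum_f_R0 f (2 * n) = sum_f_R0 (fun k => f (2 * k)%nat) n.
Proof.
intros Hf; induction n as [|n IH]; [reflexivity|].
replace (2 * S n)%nat with (S (S (2 * n))) by lia.
rewrite !tech5, IH, Hf.
replace (2 * S n)%nat with (S (S (2 * n))) by lia; ring.
Qed.

Lemma PSeries_nonneg (a : nat -> R) (y : R) :
  (forall n, 0 <= a n) -> 0 <= y -> ex_pseries a y -> 0 <= PSeries a y.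
Proof.
intros Ha Hy E.
rewrite <- (PSeries_const_0 y).
apply Series_le.
- intros n; rewrite Rmult_0_l; split; [lra|].
  apply Rmult_le_pos; [apply Ha|now apply pow_le].
- now apply (proj1 (ex_pseries_R _ _)).
Qed.

(** Splitting off the constant term leaves [a 0 + y * t] and [a 0 + z * T]. Termwise comparison
    gives [0 <= t <= T], and [T > 0] because its own constant term [a 1] is positive; hence
    [y * t < z * T]. *)
Lemma PSeries_pos_lt (a : nat -> R) (y z : R) :
  (forall n, 0 < a n) -> 0 < y < z -> ex_pseries a z ->
  0 < PSeries a y < PSeries a z.
Proof.
intros Ha [Hy Hz] Ez.
assert (Er : Rbar_lt (Rabs y) (CV_radius a)).
{ apply Rbar_lt_le_trans with (Finite (Rabs z)).
  - simpl; rewrite !Rabs_pos_eq; lra.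
  - now apply CV_radius_ge_of_ex_pseries. }
assert (Ey : ex_pseries a y) by now apply CV_radius_inside.
assert (Ez' : ex_pseries (PS_decr_1 a) z).
{ apply ex_pseries_decr_1; [right; exists (/ z)|assumption].
  unfold mult, one; simpl; field; lra. }
set (t := PSeries (PS_decr_1 a) y); set (T := PSeries (PS_decr_1 a) z).
assert (Hterm : forall n,
  0 <= PS_decr_1 a n * y ^ n <= PS_decr_1 a n * z ^ n).
{ intros n; pose proof (Ha (S n)); unfold PS_decr_1; split.
  - apply Rmult_le_pos; [lra|apply pow_le; lra].
  - apply Rmult_le_compat_l; [lra|apply pow_incr; lra]. }
assert (tT : t <= T).
{ apply Series_le; [exact Hterm|].
  now apply (proj1 (ex_pseries_R _ _)). }
assert (t0 : 0 <= t).
{ apply PSeries_nonneg; [intros n; left; apply Ha|lra|].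
  apply CV_radius_inside; now rewrite CV_radius_decr_1. }
assert (T0 : 0 < T).
{ unfold T; rewrite PSeries_decr_1 by assumption.
  assert (0 <= PSeries (PS_decr_1 (PS_decr_1 a)) z).
  { apply PSeries_nonneg; [intros n; left; apply Ha|lra|].
    apply ex_pseries_decr_1; [right; exists (/ z)|assumption].
    unfold mult, one; simpl; field; lra. }
  pose proof (Ha 1%nat); unfold PS_decr_1 at 1; nra. }
rewrite (PSeries_decr_1 a y Ey), (PSeries_decr_1 a z Ez).
fold t T; pose proof (Ha 0%nat); split; nra.
Qed.

(** * Bernoulli numbers *)

Lemma length_bern_upto (n : nat) : length (bern_upto n) = S n.
Proof.
induction n as [|n IH]; [reflexivity|].
cbn [bern_upto]; rewrite length_app, IH; simpl; lia.
Qed.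

Lemma nth_bern_upto (k n : nat) :
  (k <= n)%nat -> nth k (bern_upto n) 0 = bernoulli k.
Proof.
induction n as [|n IH]; intros Hk.
- now replace k with 0%nat by lia.
- destruct (Nat.eq_dec k (S n)) as [->|Hne]; [reflexivity|].
  cbn [bern_upto]; rewrite app_nth1 by (rewrite length_bern_upto; lia).
  apply IH; lia.
Qed.

Lemma bernoulli_S (n : nat) :
  bernoulli (S n)
  = - / (INR (S n) + 1) *
    sum_f_R0 (fun k => Binomial.C (S (S n)) k * bernoulli k) n.
Proof.
unfold bernoulli at 1; cbn [bern_upto].
rewrite app_nth2; rewrite length_bern_upto; [|lia].
rewrite Nat.sub_diag; cbn [nth].
f_equal; apply sum_eq; intros k Hk.
now rewrite nth_bern_upto by lia.
Qed.

(** * The exponential generating function and its Riccati equation *)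

Definition bern_egf (n : nat) : R := bernoulli n / INR (fact n).

(* Coefficients of (e^t - 1) / t. *)
Definition expm1_coef (n : nat) : R := / INR (fact (S n)).

(** For a positive index [n] this is the Bernoulli recursion [sum_{k<=n} C(n+1,k) B_k = 0] divided
    by [(n+1)!]. *)
Lemma PS_mult_bern_egf (n : nat) : PS_mult bern_egf expm1_coef n = PS_one n.
Proof.
destruct n as [|n].
- unfold PS_mult, bern_egf, expm1_coef, bernoulli, PS_one; simpl; field.
- unfold PS_mult; rewrite tech5, Nat.sub_diag.
  unfold bern_egf at 2; rewrite bernoulli_S.
  rewrite (sum_eq _ (fun k => (Binomial.C (S (S n)) k * bernoulli k)
                              * / INR (fact (S (S n))))).
  + rewrite <- scal_sum; unfold expm1_coef, PS_one.
    rewrite (fact_simpl (S n)), mult_INR, !S_INR.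
    change (INR (fact 1)) with 1.
    pose proof (pos_INR n); field.
    split; [lra|apply INR_fact_neq_0].
  + intros k Hk; unfold bern_egf, expm1_coef, Binomial.C.
    replace (S (S n) - k)%nat with (S (S n - k)) by lia.
    field; repeat split; apply INR_fact_neq_0.
Qed.

Lemma expm1_coef_le (n : nat) : 0 < expm1_coef n <= (/ 2) ^ n.
Proof.
unfold expm1_coef; split; [apply Rinv_0_lt_compat, INR_fact_lt_0|].
rewrite pow_inv; apply Rinv_le_contravar; [apply pow_lt; lra|].
induction n as [|n IH]; [simpl; lra|].
rewrite fact_simpl, mult_INR, !S_INR; simpl pow.
pose proof (pos_INR n); pose proof (pow_lt 2 n); nra.
Qed.

(** Solve the convolution identity for its top coefficient: by induction it is at most the geometric
    sum of [(/ 2) ^ (n - k)] over [k < n], which is below 1. The resulting radius 1 is crude, but it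
    only has to justify comparing coefficients near 0. *)
Lemma Rabs_bern_egf_le (n : nat) : Rabs (bern_egf n) <= 1.
Proof.
induction n as [n IH] using lt_wf_ind.
destruct n as [|n].
- unfold bern_egf, bernoulli; simpl; rewrite Rabs_pos_eq; lra.
- pose proof (PS_mult_bern_egf (S n)) as H.
  unfold PS_mult in H; rewrite tech5, Nat.sub_diag in H.
  unfold expm1_coef at 2 in H; simpl in H.
  assert (E : bern_egf (S n)
    = - sum_f_R0 (fun k => bern_egf k * expm1_coef (S n - k)) n).
  { simpl; rewrite Rinv_1 in H; lra. }
  rewrite E, Rabs_Ropp.
  eapply Rle_trans; [apply Rsum_abs|].
  apply Rle_trans with (sum_f_R0 (fun k => (/ 2) ^ (S n - k)) n).
  + apply sum_Rle; intros k Hk.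
    rewrite Rabs_mult.
    destruct (expm1_coef_le (S n - k)) as [H1 H2].
    rewrite (Rabs_pos_eq (expm1_coef _)) by lra.
    assert (Rabs (bern_egf k) <= 1) by (apply IH; lia).
    pose proof (Rabs_pos (bern_egf k)); nra.
  + clear.
    assert (forall n, sum_f_R0 (fun k => (/ 2) ^ (S n - k)) n = 1 - (/ 2) ^ S n)
      as ->.
    { intros m; induction m as [|m IH]; [simpl; lra|].
      rewrite tech5.
      rewrite (sum_eq _ (fun k => (/ 2) ^ (S m - k) * / 2)).
      - rewrite <- scal_sum, IH.
        replace (S (S m) - S m)%nat with 1%nat by lia; simpl; lra.
      - intros k Hk; replace (S (S m) - k)%nat with (S (S m - k)) by lia.
        simpl; ring. }
    pose proof (pow_lt (/ 2) (S n)); lra.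
Qed.

Lemma CV_radius_bern_egf (t : R) :
  Rabs t < 1 -> Rbar_lt (Rabs t) (CV_radius bern_egf).
Proof.
intros Ht; apply (CV_radius_gt_of_bound _ 1 1); [|exact Ht].
intros n; rewrite pow1, Rmult_1_r; apply Rabs_bern_egf_le.
Qed.

Lemma CV_radius_expm1_coef (t : R) :
  Rabs t < 1 -> Rbar_lt (Rabs t) (CV_radius expm1_coef).
Proof.
intros Ht; apply (CV_radius_gt_of_bound _ 1 1); [|exact Ht].
intros n; rewrite pow1, Rmult_1_r.
destruct (expm1_coef_le n).
rewrite Rabs_pos_eq by lra.
assert (0 < (/ 2) ^ n <= 1); [|lra].
split; [apply pow_lt; lra|].
rewrite <- (pow1 n); apply pow_incr; lra.
Qed.

Lemma PSeries_expm1_coef (t : R) : t * PSeries expm1_coef t = exp t - 1.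
Proof.
pose proof (is_exp_Reals t) as H.
rewrite <- (is_pseries_unique _ _ _ H).
rewrite (PSeries_decr_1 (fun n => / INR (fact n))) by (now exists (exp t)).
simpl; rewrite Rinv_1; unfold PS_decr_1, expm1_coef; ring.
Qed.

Lemma PSeries_bern_egf (t : R) :
  Rabs t < 1 -> PSeries bern_egf t * (exp t - 1) = t.
Proof.
intros Ht.
rewrite <- PSeries_expm1_coef.
transitivity (t * (PSeries bern_egf t * PSeries expm1_coef t)); [ring|].
rewrite <- PSeries_mult
  by (now apply CV_radius_bern_egf || now apply CV_radius_expm1_coef).
rewrite (PSeries_ext _ _ _ PS_mult_bern_egf).
rewrite (is_pseries_unique _ _ _ (is_pseries_one t)); ring.
Qed.

(* Multiplying the derivative of G (e^t - 1) = t by G eliminates e^t. *)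
Lemma PSeries_bern_egf_ode (t : R) :
  Rabs t < 1 ->
  t * PSeries (PS_derive bern_egf) t
  = PSeries bern_egf t - t * PSeries bern_egf t - PSeries bern_egf t ^ 2.
Proof.
intros Ht.
set (G := PSeries bern_egf t); set (G' := PSeries (PS_derive bern_egf) t).
assert (HG : is_derive (PSeries bern_egf) t G')
  by now apply is_derive_PSeries, CV_radius_bern_egf.
assert (D1 : is_derive (fun t => PSeries bern_egf t * (exp t - 1)) t
               (G' * (exp t - 1) + G * exp t)).
{ auto_derive; [now exists G'|].
  replace (Derive _ t) with G' by (symmetry; apply is_derive_unique, HG).
  unfold G; ring. }
assert (D2 : is_derive (fun t => PSeries bern_egf t * (exp t - 1)) t 1).
{ apply (is_derive_ext_loc (fun t => t)).
  - assert (Hd : 0 < 1 - Rabs t) by lra.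
    exists (mkposreal _ Hd); intros s Hs.
    symmetry; apply PSeries_bern_egf.
    unfold ball in Hs; simpl in Hs; unfold AbsRing_ball in Hs; simpl in Hs.
    unfold abs, minus, plus, opp in Hs; simpl in Hs.
    replace s with ((s + - t) + t) by ring.
    eapply Rle_lt_trans; [apply Rabs_triang|lra].
  - apply (is_derive_id (K := R_AbsRing)). }
assert (E : G' * (exp t - 1) + G * exp t = 1).
{ rewrite <- (is_derive_unique _ _ _ D1); now apply is_derive_unique. }
pose proof (PSeries_bern_egf t Ht) as H; fold G in H.
replace (t * G') with (G * (G' * (exp t - 1)))
  by (transitivity (G * (exp t - 1) * G'); [ring|now rewrite H]).
replace (t * G) with (G * (exp t - 1) * G) by (rewrite H; ring).
replace (G' * (exp t - 1)) with (1 - G * exp t) by lra.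
ring.
Qed.

(* Coefficients of t / (e^t - 1) + t / 2 = (t / 2) coth (t / 2). *)
Definition coth_coef : nat -> R :=
  PS_plus bern_egf (PS_scal (/ 2) (PS_incr_1 PS_one)).

Lemma CV_radius_coth_coef (t : R) :
  Rabs t < 1 -> Rbar_lt (Rabs t) (CV_radius coth_coef).
Proof.
intros Ht; apply (CV_radius_gt_of_bound _ 1 2); [|exact Ht].
intros n; rewrite pow1, Rmult_1_r.
unfold coth_coef, PS_plus, PS_scal, plus, scal; simpl; unfold mult; simpl.
eapply Rle_trans; [apply Rabs_triang|].
pose proof (Rabs_bern_egf_le n).
assert (Rabs (/ 2 * PS_incr_1 PS_one n) <= 1); [|lra].
destruct n as [|[|n]]; simpl; unfold zero; simpl; rewrite Rabs_pos_eq; lra.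
Qed.

Lemma PSeries_coth_coef (t : R) :
  Rabs t < 1 -> PSeries coth_coef t = PSeries bern_egf t + t / 2.
Proof.
intros Ht; unfold coth_coef; rewrite PSeries_plus.
- rewrite PSeries_scal, PSeries_incr_1.
  rewrite (is_pseries_unique _ _ _ (is_pseries_one t)); field.
- now apply CV_radius_inside, CV_radius_bern_egf.
- apply ex_pseries_scal; [apply Rmult_comm|].
  apply ex_pseries_incr_1; exists 1; apply is_pseries_one.
Qed.

Lemma PSeries_derive_coth_coef (t : R) :
  Rabs t < 1 ->
  PSeries (PS_derive coth_coef) t = PSeries (PS_derive bern_egf) t + / 2.
Proof.
intros Ht.
rewrite (PSeries_ext _ (PS_plus (PS_derive bern_egf) (PS_scal (/ 2) PS_one))).
- rewrite PSeries_plus.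
  + rewrite PSeries_scal.
    rewrite (is_pseries_unique _ _ _ (is_pseries_one t)); field.
  + now apply ex_pseries_derive, CV_radius_bern_egf.
  + apply ex_pseries_scal; [apply Rmult_comm|].
    exists 1; apply is_pseries_one.
- intros n; unfold PS_derive, coth_coef, PS_plus, PS_scal, plus, scal; simpl.
  unfold mult; simpl; destruct n as [|n]; simpl; ring.
Qed.

(** Completing the square with [H = G + t/2] turns the equation for [G] into
    [t H' + H^2 = H + t^2/4]. Both sides are power series that agree for [|t| < 1], so their
    coefficients agree; the exceptional [/ 4] comes from [t^2/4]. *)
Lemma coth_coef_rec (n : nat) :
  INR n * coth_coef n + PS_mult coth_coef coth_coef n
  = coth_coef n + match n with 2%nat => / 4 | _ => 0 end.
Proof.
assert (Ex : forall t, Rabs t < 1 ->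
  ex_pseries (PS_incr_1 (PS_derive coth_coef)) t /\
  ex_pseries (PS_mult coth_coef coth_coef) t /\
  ex_pseries coth_coef t /\
  ex_pseries (PS_scal (/ 4) (PS_incr_1 (PS_incr_1 PS_one))) t).
{ intros t Ht; repeat split.
  - now apply ex_pseries_incr_1, ex_pseries_derive, CV_radius_coth_coef.
  - now apply ex_pseries_mult; apply CV_radius_coth_coef.
  - now apply CV_radius_inside, CV_radius_coth_coef.
  - apply ex_pseries_scal; [apply Rmult_comm|].
    apply ex_pseries_incr_1, ex_pseries_incr_1; exists 1; apply is_pseries_one. }
assert (Hhalf : Rabs (/ 2) < 1) by (rewrite Rabs_pos_eq; lra).
pose proof (PSeries_ext_recip
  (PS_plus (PS_incr_1 (PS_derive coth_coef)) (PS_mult coth_coef coth_coef))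
  (PS_plus coth_coef (PS_scal (/ 4) (PS_incr_1 (PS_incr_1 PS_one)))) n) as H.
transitivity (PS_plus (PS_incr_1 (PS_derive coth_coef))
                (PS_mult coth_coef coth_coef) n).
{ unfold PS_plus, PS_derive, plus; simpl.
  destruct n; [|reflexivity].
  unfold PS_incr_1, zero; simpl; ring. }
rewrite H.
- unfold PS_plus, PS_scal, plus, scal; simpl; unfold mult; simpl.
  f_equal; destruct n as [|[|[|n]]]; simpl; unfold zero; simpl; ring.
- apply CV_radius_gt_0_of_ex_pseries with (/ 2); [lra|].
  destruct (Ex _ Hhalf) as (A1 & A2 & _ & _); now apply ex_pseries_plus.
- apply CV_radius_gt_0_of_ex_pseries with (/ 2); [lra|].
  destruct (Ex _ Hhalf) as (_ & _ & A3 & A4); now apply ex_pseries_plus.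
- exists (mkposreal 1 Rlt_0_1); intros t Ht.
  unfold ball in Ht; simpl in Ht; unfold AbsRing_ball in Ht; simpl in Ht.
  unfold abs, minus, plus, opp in Ht; simpl in Ht.
  rewrite Ropp_0, Rplus_0_r in Ht.
  destruct (Ex _ Ht) as (A1 & A2 & A3 & A4).
  rewrite !PSeries_plus by assumption.
  rewrite PSeries_scal, !PSeries_incr_1.
  rewrite (is_pseries_unique _ _ _ (is_pseries_one t)).
  rewrite PSeries_mult by now apply CV_radius_coth_coef.
  rewrite PSeries_derive_coth_coef, PSeries_coth_coef by assumption.
  pose proof (PSeries_bern_egf_ode t Ht).
  rewrite Rmult_plus_distr_l, H0; field.
Qed.

Lemma coth_coef_0 : coth_coef 0 = 1.
Proof.
unfold coth_coef, PS_plus, PS_scal, bern_egf, bernoulli; simpl.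
unfold plus, scal, zero; simpl; unfold mult; simpl; field.
Qed.

Lemma coth_coef_1 : coth_coef 1 = 0.
Proof.
unfold coth_coef, PS_plus, PS_scal, bern_egf, bernoulli; simpl.
unfold plus, scal; simpl; unfold mult; simpl.
unfold Binomial.C; simpl; field.
Qed.

(** At an odd index [n >= 3] the recursion reads [(n+1) h_n = - sum h_i h_{n-i}] over [0 < i < n].
    Since [n] is odd, each product has a factor of smaller odd index, which vanishes by
    induction. *)
Lemma coth_coef_odd (k : nat) : coth_coef (S (2 * k)) = 0.
Proof.
induction k as [k IH] using lt_wf_ind.
destruct k as [|k]; [exact coth_coef_1|].
replace (S (2 * S k)) with (S (S (S (2 * k)))) by lia.
pose proof (coth_coef_rec (S (S (S (2 * k))))) as H.
rewrite PS_mult_self_SS, coth_coef_0 in H.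
replace (PS_mult (PS_decr_1 coth_coef) (PS_decr_1 coth_coef) (S (2 * k)))
  with 0 in H.
- rewrite 3!S_INR in H; pose proof (pos_INR (2 * k)); nra.
- symmetry; unfold PS_mult; apply sum_eq_R0; intros i Hi; unfold PS_decr_1.
  destruct (Nat.Even_or_Odd i) as [[j ->]|[j ->]].
  + rewrite IH by lia; ring.
  + replace (S (S (2 * k) - (2 * j + 1))) with (S (2 * (k - j))) by lia.
    rewrite (IH (k - j)%nat) by lia; ring.
Qed.

(** * The cotangent series *)

(* Coefficients of x cot x as a power series in x^2: substitute t = 2 i x. *)
Definition cot_coef (k : nat) : R := (-4) ^ k * coth_coef (2 * k).

(** The recursion for [coth_coef] at index [2n], scaled by [(-4)^n]. As the odd coefficients vanish,
    the Cauchy square only involves the even ones; [/ 4] becomes [-1]. *)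
Lemma cot_coef_rec (n : nat) :
  2 * INR n * cot_coef n + PS_mult cot_coef cot_coef n
  = cot_coef n - match n with 1%nat => 1 | _ => 0 end.
Proof.
pose proof (coth_coef_rec (2 * n)) as H.
assert (E : PS_mult cot_coef cot_coef n
            = (-4) ^ n * PS_mult coth_coef coth_coef (2 * n)).
{ unfold PS_mult; rewrite sum_f_R0_even.
  - rewrite scal_sum; apply sum_eq; intros i Hi; unfold cot_coef.
    replace (2 * n - 2 * i)%nat with (2 * (n - i))%nat by lia.
    replace ((-4) ^ n) with ((-4) ^ i * (-4) ^ (n - i))
      by (rewrite <- pow_add; f_equal; lia).
    ring.
  - intros k; rewrite coth_coef_odd; ring. }
rewrite E; unfold cot_coef.
rewrite mult_INR in H; simpl (INR 2) in H.
transitivity ((-4) ^ n * ((1 + 1) * INR n * coth_coef (2 * n)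
               + PS_mult coth_coef coth_coef (2 * n))); [ring|].
rewrite H; destruct n as [|[|n]].
- simpl; ring.
- simpl; field.
- replace (2 * S (S n))%nat with (S (S (S (S (2 * n))))) by lia; ring.
Qed.

Lemma cot_coef_0 : cot_coef 0 = 1.
Proof. unfold cot_coef; simpl; rewrite coth_coef_0; ring. Qed.

Lemma cot_coef_1 : cot_coef 1 = - / 3.
Proof.
pose proof (cot_coef_rec 1) as H; unfold PS_mult in H; simpl in H.
rewrite cot_coef_0 in H; lra.
Qed.

(** The end terms of the square contribute [2 * cot_coef (n+2)], so the total factor is
    [2(n+2) + 2 - 1 = 2n + 5]. With the sign changed, every quantity in the recursion is
    positive. *)
Lemma cot_coef_SS (n : nat) :
  (2 * INR n + 5) * - cot_coef (S (S n))
  = sum_f_R0 (fun k => - cot_coef (S k) * - cot_coef (S (n - k))) n.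
Proof.
pose proof (cot_coef_rec (S (S n))) as H.
rewrite PS_mult_self_SS, cot_coef_0, 2!S_INR in H.
unfold PS_mult, PS_decr_1 in H.
rewrite (sum_eq _ (fun k => cot_coef (S k) * cot_coef (S (n - k))))
  by (intros; ring).
lra.
Qed.

(** Each of the [n+1] summands is at most [(/ 6)^n / 9], and [(n+1)/9 <= (2n+5)/18]. The ratio [/ 6]
    is the limit of [(n+1) / (3(2n+5))], the smallest for which this induction closes. *)
Lemma cot_coef_S_bounds (n : nat) :
  0 < - cot_coef (S n) <= / 3 * (/ 6) ^ n.
Proof.
induction n as [n IH] using lt_wf_ind.
destruct n as [|n]; [rewrite cot_coef_1; simpl; lra|].
pose proof (cot_coef_SS n) as H; pose proof (pos_INR n) as Hn.
split.
- apply Rmult_lt_reg_l with (2 * INR n + 5); [lra|].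
  rewrite Rmult_0_r, H.
  apply tech1; intros k Hk.
  apply Rmult_lt_0_compat; apply IH; lia.
- apply Rmult_le_reg_l with (2 * INR n + 5); [lra|].
  rewrite H.
  apply Rle_trans with (sum_f_R0 (fun _ => / 9 * (/ 6) ^ n) n).
  + apply sum_Rle; intros k Hk.
    replace (/ 9 * (/ 6) ^ n)
      with ((/ 3 * (/ 6) ^ k) * (/ 3 * (/ 6) ^ (n - k))).
    * destruct (IH k) as [H1 H2]; [lia|].
      destruct (IH (n - k)%nat) as [H3 H4]; [lia|].
      apply Rmult_le_compat; lra.
    * replace ((/ 6) ^ n) with ((/ 6) ^ k * (/ 6) ^ (n - k))
        by (rewrite <- pow_add; f_equal; lia).
      field; repeat split; try lra; apply pow_nonzero; lra.
  + rewrite sum_cte, S_INR; simpl pow.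
    pose proof (pow_lt (/ 6) n); nra.
Qed.

Lemma CV_radius_cot_coef (y : R) :
  Rabs y < 6 -> Rbar_lt (Rabs y) (CV_radius cot_coef).
Proof.
(* The bound 2 is [6 * / 3], from [6 ^ S n] against [/ 3 * (/ 6) ^ n]; it also covers the constant
   term 1. *)
intros Hy; apply (CV_radius_gt_of_bound _ 6 2); [|exact Hy].
intros [|n]; [rewrite cot_coef_0; simpl; rewrite Rabs_pos_eq; lra|].
destruct (cot_coef_S_bounds n) as [H1 H2].
assert (H6 : 0 < 6 ^ n) by (apply pow_lt; lra).
rewrite Rabs_mult, <- Rabs_Ropp, !Rabs_pos_eq by (simpl; lra).
apply Rle_trans with (/ 3 * (/ 6) ^ n * 6 ^ S n).
- apply Rmult_le_compat_r; simpl; lra.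
- rewrite pow_inv; simpl; right; field; lra.
Qed.

(** The coefficient recursion summed back into the equation that [x cot x] satisfies in the variable
    [y = x^2]. *)
Lemma PSeries_cot_coef_ode (y : R) :
  Rabs y < 6 ->
  2 * y * PSeries (PS_derive cot_coef) y
  = PSeries cot_coef y - PSeries cot_coef y ^ 2 - y.
Proof.
intros Hy.
pose proof (CV_radius_cot_coef y Hy) as Hr.
replace (2 * y * PSeries (PS_derive cot_coef) y)
  with (PSeries (PS_scal 2 (PS_incr_1 (PS_derive cot_coef))) y)
  by (rewrite PSeries_scal, PSeries_incr_1; ring).
replace (PSeries cot_coef y ^ 2) with (PSeries (PS_mult cot_coef cot_coef) y)
  by (rewrite PSeries_mult by assumption; ring).
replace y with (PSeries (PS_incr_1 PS_one) y) at 4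
  by (rewrite PSeries_incr_1,
        (is_pseries_unique _ _ _ (is_pseries_one y)); ring).
assert (ex_pseries cot_coef y) by now apply CV_radius_inside.
assert (ex_pseries (PS_mult cot_coef cot_coef) y) by now apply ex_pseries_mult.
assert (ex_pseries (PS_incr_1 PS_one) y)
  by (apply ex_pseries_incr_1; exists 1; apply is_pseries_one).
rewrite <- !PSeries_minus by (try apply ex_pseries_minus; assumption).
apply PSeries_ext; intros n.
pose proof (cot_coef_rec n) as E.
unfold PS_scal, PS_minus, PS_plus, PS_opp, plus, opp, scal; simpl.
unfold mult; simpl.
destruct n as [|[|n]]; unfold PS_incr_1, PS_derive, zero; simpl in *; lra.
Qed.

(* H := sin x * U(x^2) - x cos x, with U the series, satisfies x H' = (1 - U) H;
   since (1 - U(x^2)) / x is the derivative of a power series, the integrating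
   factor forces H = 0. *)
Lemma sin_mul_PSeries_cot_coef (x : R) :
  0 < x -> x ^ 2 < 6 -> sin x * PSeries cot_coef (x ^ 2) = x * cos x.
Proof.
intros Hx Hx6.
(* [p] is the primitive of [(U(y) - 1) / y], so [p(t^2) / 2] has derivative [(U(t^2) - 1) / t]. *)
set (p := PS_Int (PS_decr_1 cot_coef)).
assert (Hp : forall y, Rabs y < 6 -> Rbar_lt (Rabs y) (CV_radius p)).
{ intros y Hy; unfold p; rewrite CV_radius_Int, CV_radius_decr_1.
  now apply CV_radius_cot_coef. }
assert (Hdp : forall y, Rabs y < 6 ->
  is_derive (PSeries p) y (PSeries (PS_decr_1 cot_coef) y)).
{ intros y Hy.
  rewrite (PSeries_ext _ (PS_derive p)).
  - now apply is_derive_PSeries, Hp.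
  - intros n; unfold p, PS_Int, PS_derive; simpl pred.
    change (cot_coef (S n) = INR (S n) * (cot_coef (S n) / INR (S n))).
    field; apply not_0_INR; lia. }
assert (Hd : forall y, Rabs y < 6 ->
  PSeries cot_coef y = 1 + y * PSeries (PS_decr_1 cot_coef) y).
{ intros y Hy; rewrite PSeries_decr_1, cot_coef_0; [reflexivity|].
  now apply CV_radius_inside, CV_radius_cot_coef. }
set (f := fun t => (sin t * PSeries cot_coef (t ^ 2) - t * cos t)
                   * exp (/ 2 * PSeries p (t ^ 2))).
assert (Hf : f 0 = f x).
{ apply (eq_is_derive (V := R_NormedModule) f 0 x); [|exact Hx].
  intros t Ht.
  assert (Hy : Rabs (t ^ 2) < 6) by (rewrite Rabs_pos_eq; nra).
  pose proof (is_derive_PSeries _ _ (CV_radius_cot_coef _ Hy)) as D1.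
  pose proof (Hdp _ Hy) as D2.
  unfold f; auto_derive.
  - repeat split; [eexists; exact D1|eexists; exact D2].
  - simpl pow in D1, D2.
    replace (Derive (fun y => PSeries cot_coef y) (t * (t * 1)))
      with (PSeries (PS_derive cot_coef) (t * (t * 1)))
      by (symmetry; apply is_derive_unique, D1).
    replace (Derive (fun y => PSeries p y) (t * (t * 1)))
      with (PSeries (PS_decr_1 cot_coef) (t * (t * 1)))
      by (symmetry; apply is_derive_unique, D2).
    pose proof (PSeries_cot_coef_ode _ Hy) as O.
    pose proof (Hd _ Hy) as E; simpl pow in *.
    (* Away from 0 the Riccati equation can be solved for [U']; at 0 the derivative vanishes by
       direct evaluation. *)
    destruct (Req_dec t 0) as [->|Ht0].
    + rewrite sin_0, cos_0; unfold zero; simpl.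
      rewrite E; ring.
    + unfold zero; simpl.
      set (U := PSeries cot_coef (t * (t * 1))) in *.
      set (U' := PSeries (PS_derive cot_coef) (t * (t * 1))) in *.
      set (W := PSeries (PS_decr_1 cot_coef) (t * (t * 1))) in *.
      assert (EW : W = (U - 1) / t ^ 2) by (rewrite E; field; assumption).
      assert (EU : U' = (U - U * (U * 1) - t * (t * 1)) / (2 * t ^ 2))
        by (rewrite <- O; field; assumption).
      rewrite EW, EU; field; assumption. }
unfold f in Hf; rewrite sin_0 in Hf.
rewrite !Rmult_0_l, Rminus_0_r, Rmult_0_l in Hf.
symmetry in Hf; apply Rmult_integral in Hf.
pose proof (exp_pos (/ 2 * PSeries p (x ^ 2))).
destruct Hf; lra.
Qed.

Lemma PI_half_sq_lt_6 : (PI / 2) ^ 2 < 6.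
Proof. pose proof PI_4; pose proof PI_RGT_0; nra. Qed.

(** This is [1 / sin x = cot (x/2) - cot x] multiplied by [x]. The endpoint [PI / 2] is included
    because the upper bound compares with the value there. *)
Lemma x_div_sin_eq (x : R) :
  0 < x <= PI / 2 ->
  x / sin x = 2 * PSeries cot_coef (x ^ 2 / 4) - PSeries cot_coef (x ^ 2).
Proof.
intros [H0 H1].
pose proof PI_half_sq_lt_6 as H6.
assert (Hx : x ^ 2 < 6) by nra.
pose proof (sin_mul_PSeries_cot_coef x H0 Hx) as E1.
assert (E2 : sin (x / 2) * PSeries cot_coef (x ^ 2 / 4) = x / 2 * cos (x / 2)).
{ replace (x ^ 2 / 4) with ((x / 2) ^ 2) by field.
  apply sin_mul_PSeries_cot_coef; nra. }
assert (Hs : 0 < sin x) by (apply sin_gt_0; pose proof PI_RGT_0; lra).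
apply Rmult_eq_reg_l with (sin x); [|lra].
rewrite Rmult_minus_distr_l, E1.
replace (sin x * (x / sin x)) with x by (field; lra).
(* These occurrences are the arguments of [sin] and [cos], prepared for the double-angle
   formulas. *)
replace x with (2 * (x / 2)) at 2 5 by field.
rewrite sin_2a, cos_2a_cos.
transitivity (4 * cos (x / 2) * (sin (x / 2) * PSeries cot_coef (x ^ 2 / 4))
  - x * (2 * cos (x / 2) * cos (x / 2) - 1)); [rewrite E2; field|ring].
Qed.

(** * The series of 3 x / sin x + cos x *)

(** The constant term is set apart because [c 0 = -2]: the sign pattern that [Rabs] removes from
    [B_{2k}] is broken at [B_0]. *)
Definition target_coef (k : nat) : R :=
  match k with O => 4 | S _ => c k end.

(** [cot_coef (S k)] is negative, which settles the absolute value; the correction [t/2] affects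
    only index 1, so [coth_coef] is here the Bernoulli quotient itself. *)
Lemma abs_bernoulli_even (k : nat) :
  Rabs (bernoulli (2 * S k)) / INR (fact (2 * S k))
  = - cot_coef (S k) / 4 ^ S k.
Proof.
pose proof (INR_fact_lt_0 (2 * S k)) as Hf.
assert (E : cot_coef (S k)
            = (-4) ^ S k * (bernoulli (2 * S k) / INR (fact (2 * S k)))).
{ unfold cot_coef, coth_coef, PS_plus, PS_scal, plus, scal; simpl.
  unfold mult; simpl; unfold bern_egf; fold (fact (2 * S k)).
  replace (k + S (k + 0))%nat with (S (2 * k)) by lia; simpl; ring. }
assert (A : Rabs (cot_coef (S k)) = - cot_coef (S k))
  by (apply Rabs_left; destruct (cot_coef_S_bounds k); lra).
assert (H4 : 4 ^ S k <> 0) by (apply pow_nonzero; lra).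
rewrite <- A, E, Rabs_mult, <- RPow_abs, Rabs_div by lra.
rewrite (Rabs_pos_eq (INR _)) by lra.
replace (Rabs (-4)) with 4 by (rewrite Rabs_left; lra).
field; lra.
Qed.

(** With [U] the cotangent series, the right side is the coefficient of [y^k] in
    [3 (2 U(y/4) - U(y))] plus that of the cosine series in [y = x^2]. *)
Lemma target_coef_eq (k : nat) :
  target_coef k
  = 3 * (2 * (cot_coef k / 4 ^ k) - cot_coef k) + (-1) ^ k / INR (fact (2 * k)).
Proof.
destruct k as [|k]; [simpl; rewrite cot_coef_0; field|].
unfold target_coef, c.
assert (H4 : 4 ^ S k <> 0) by (apply pow_nonzero; lra).
assert (E : 2 ^ (2 * S k) = 4 ^ S k)
  by (rewrite pow_mult; f_equal; simpl; lra).
transitivity (3 * (Rabs (bernoulli (2 * S k)) / INR (fact (2 * S k)))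
              * (2 ^ (2 * S k) - 2) + (-1) ^ S k / INR (fact (2 * S k))).
- field; apply INR_fact_neq_0.
- rewrite abs_bernoulli_even, E; field.
  split; [apply INR_fact_neq_0|exact H4].
Qed.

Lemma is_pseries_target (x : R) :
  0 < x <= PI / 2 ->
  is_pseries target_coef (x ^ 2) (3 * (x / sin x) + cos x).
Proof.
intros Hx; rewrite (x_div_sin_eq x Hx).
pose proof PI_half_sq_lt_6 as H6.
assert (Hx6 : Rabs (x ^ 2) < 6) by (rewrite Rabs_pos_eq; nra).
assert (Hx4 : Rabs (x ^ 2 / 4) < 6) by (rewrite Rabs_pos_eq; nra).
pose proof (PSeries_correct _ _ (CV_radius_inside _ _ (CV_radius_cot_coef _ Hx6)))
  as S1.
pose proof (PSeries_correct _ _ (CV_radius_inside _ _ (CV_radius_cot_coef _ Hx4)))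
  as S2.
apply is_pseries_R in S1; apply is_pseries_R in S2.
assert (S3 : is_series (fun n => (-1) ^ n / INR (fact (2 * n)) * (x ^ 2) ^ n)
               (cos x)).
(* [cos] is defined as the sum of exactly this series in [Rsqr x]. *)
{ unfold cos; destruct (exist_cos (Rsqr x)) as [l Hl]; simpl.
  apply is_series_Reals; unfold cos_in, cos_n in Hl.
  now replace (x * (x * 1)) with (Rsqr x) by (unfold Rsqr; ring). }
apply is_pseries_R.
eapply is_series_ext;
  [|apply (is_series_plus (V := R_NormedModule)); [|exact S3];
    apply (is_series_scal_l (V := R_NormedModule) 3);
    apply (is_series_minus (V := R_NormedModule)); [|exact S1];
    apply (is_series_scal_l (V := R_NormedModule) 2); exact S2].
intros n; rewrite target_coef_eq.
unfold plus, opp, minus, scal; simpl; unfold plus, opp, mult; simpl.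
set (y := x * (x * 1)).
replace ((y / 4) ^ n) with (y ^ n / 4 ^ n)
  by (unfold Rdiv; rewrite Rpow_mult_distr, pow_inv; ring).
field; split; [apply (INR_fact_neq_0 (2 * n))|apply pow_nonzero; lra].
Qed.

(** Write [b_k = - cot_coef k]. The start is [b_3 = 2/945]; at [k = 2] the bound fails, since
    [1/30 < 1/24]. Keeping only the summand [b_1 b_k] of the recursion shows that [b] shrinks by at
    most [3(2n+9)] per step, while the factorial grows by [(2n+8)(2n+7)], which is larger. *)
Lemma cot_coef_ge_inv_fact (n : nat) :
  / INR (fact (2 * (n + 3))) <= 3 / 2 * - cot_coef (n + 3).
Proof.
induction n as [|n IH].
- pose proof (cot_coef_SS 0) as H2; pose proof (cot_coef_SS 1) as H3.
  simpl in H2, H3; rewrite cot_coef_1 in H2, H3.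
  replace (INR (fact (2 * (0 + 3)))) with 720
    by (rewrite INR_IZR_INZ; reflexivity).
  change (0 + 3)%nat with 3%nat; lra.
- replace (S n + 3)%nat with (S (S (S (S n)))) by lia.
  replace (n + 3)%nat with (S (S (S n))) in IH by lia.
  pose proof (cot_coef_SS (S (S n))) as H.
  rewrite decomp_sum in H by lia; simpl pred in H.
  assert (0 < sum_f_R0 (fun i => - cot_coef (S (S i))
                        * - cot_coef (S (S (S n) - S i))) (S n)).
  { apply tech1; intros k _; apply Rmult_lt_0_compat;
      apply cot_coef_S_bounds. }
  rewrite cot_coef_1 in H; simpl (S (S n) - 0)%nat in H.
  set (b := - cot_coef (S (S (S n)))) in *.
  set (b' := - cot_coef (S (S (S (S n))))) in *.
  assert (Hb : 0 < b) by apply cot_coef_S_bounds.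
  pose proof (pos_INR n) as Hn.
  assert (L : / 3 * b <= (2 * INR n + 9) * b')
    by (rewrite !S_INR in H; lra).
  replace (2 * S (S (S (S n))))%nat with (S (S (2 * S (S (S n))))) by lia.
  rewrite 2!fact_simpl, 2!mult_INR.
  replace (INR (S (S (2 * S (S (S n)))))) with (2 * INR n + 8)
    by (rewrite 2!S_INR, mult_INR, !S_INR; simpl (INR 0); ring).
  replace (INR (S (2 * S (S (S n))))) with (2 * INR n + 7)
    by (rewrite S_INR, mult_INR, !S_INR; simpl (INR 0); ring).
  set (F := INR (fact (2 * S (S (S n))))) in *.
  assert (HF : 0 < F) by apply INR_fact_lt_0.
  rewrite !Rinv_mult, <- Rmult_assoc.
  assert (HQ : 0 < (2 * INR n + 8) * (2 * INR n + 7)) by nra.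
  rewrite <- Rinv_mult.
  apply Rmult_le_reg_l with ((2 * INR n + 8) * (2 * INR n + 7)); [exact HQ|].
  rewrite <- Rmult_assoc, Rinv_r, Rmult_1_l by lra.
  apply Rle_trans with (1 := IH).
  assert (3 * (2 * INR n + 9) <= (2 * INR n + 8) * (2 * INR n + 7)) by nra.
  assert (0 < b') by apply cot_coef_S_bounds.
  nra.
Qed.

(** The cotangent part is [3 b_k (1 - 2/4^k)] with [b_k = - cot_coef k]. As [4^k > 4], it exceeds
    [3/2 b_k], hence the cosine term [1/(2k)!] even when that one is negative. *)
Lemma target_coef_pos (k : nat) : (3 <= k)%nat -> 0 < target_coef k.
Proof.
intros Hk; rewrite target_coef_eq.
replace k with ((k - 3) + 3)%nat by lia.
set (n := (k - 3)%nat).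
pose proof (cot_coef_ge_inv_fact n) as H.
assert (Hb : 0 < - cot_coef (n + 3)).
{ replace (n + 3)%nat with (S (n + 2)) by lia; apply cot_coef_S_bounds. }
assert (H4 : 4 < 4 ^ (n + 3)).
{ rewrite pow_add; pose proof (pow_R1_Rle 4 n); simpl; lra. }
assert (Hi : / 4 ^ (n + 3) < / 4) by (apply Rinv_lt_contravar; lra).
assert (Hs : - / INR (fact (2 * (n + 3)))
             <= (-1) ^ (n + 3) / INR (fact (2 * (n + 3)))).
{ pose proof (Rinv_0_lt_compat _ (INR_fact_lt_0 (2 * (n + 3)))).
  pose proof (Rle_abs (- (-1) ^ (n + 3))) as Ha.
  rewrite Rabs_Ropp, pow_1_abs in Ha; unfold Rdiv; nra. }
unfold Rdiv at 1; nra.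
Qed.

(** * Partial sums, tails and the two bounds *)

Lemma csum_eq (n : nat) (x : R) :
  4 + csum n x = sum_f_R0 (fun k => target_coef k * (x ^ 2) ^ k) n.
Proof.
induction n as [|n IH]; [simpl; ring|].
rewrite tech5, <- IH.
cbn [csum target_coef]; rewrite (pow_mult x 2 (S n)); ring.
Qed.

Theorem theorem6 (x : R) (m : nat) :
  0 < x < PI / 2 -> (3 <= m)%nat ->
  4 + csum (m - 1) x
    + (2 * x / PI) ^ (2 * m) * (3 * PI / 2 - 4 - csum (m - 1) (PI / 2))
    > 3 * (x / sin x) + cos x
  /\ 3 * (x / sin x) + cos x > 4 + csum m x.
Proof.
intros [H0 H1] Hm.
assert (tail : forall n t, 0 < t <= PI / 2 ->
  3 * (t / sin t) + cos t
  = 4 + csum n t + (t ^ 2) ^ S n * PSeries (PS_decr_n target_coef (S n)) (t ^ 2)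
  /\ ex_pseries (PS_decr_n target_coef (S n)) (t ^ 2)).
{ intros n t Ht; pose proof (is_pseries_target t Ht) as H; split.
  - rewrite csum_eq, <- (is_pseries_unique _ _ _ H).
    apply PSeries_decr_n; eexists; exact H.
  - apply ex_pseries_decr_n; [right|eexists; exact H].
    exists (/ t ^ 2); unfold mult, one; simpl; field; lra. }
(* The tail after [csum n] starts at index [n + 1 >= 3], where all coefficients are positive; this
   is where [m >= 3] enters, through [n = m - 1]. *)
assert (tail_lt : forall n, (2 <= n)%nat ->
  0 < PSeries (PS_decr_n target_coef (S n)) (x ^ 2)
    < PSeries (PS_decr_n target_coef (S n)) ((PI / 2) ^ 2)).
{ intros n Hn; apply PSeries_pos_lt.
  - intros k; apply target_coef_pos; lia.
  - split; nra.
  - apply tail; lra. }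
split.
- destruct (tail (m - 1)%nat x) as [E1 _]; [lra|].
  destruct (tail (m - 1)%nat (PI / 2)) as [E2 _]; [lra|].
  destruct (tail_lt (m - 1)%nat) as [_ L]; [lia|].
  (* At [PI / 2] the function equals [3 * PI / 2], so [E2] identifies the bracket of the upper bound
     as [(PI/2)^(2m)] times the tail series at [(PI/2)^2]. The factor [(2x/PI)^(2m)] then turns this
     power into [x^(2m)]. *)
  rewrite sin_PI2, cos_PI2 in E2.
  replace (S (m - 1)) with m in * by lia.
  rewrite E1; apply Rplus_lt_compat_l.
  replace (3 * PI / 2 - 4 - csum (m - 1) (PI / 2))
    with (((PI / 2) ^ 2) ^ m * PSeries (PS_decr_n target_coef m) ((PI / 2) ^ 2))
    by lra.
  rewrite pow_mult, <- Rmult_assoc, <- Rpow_mult_distr.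
  replace ((2 * x / PI) ^ 2 * (PI / 2) ^ 2) with (x ^ 2) by (field; lra).
  apply Rmult_lt_compat_l; [apply pow_lt; nra|exact L].
- destruct (tail m x) as [E _]; [lra|].
  destruct (tail_lt m) as [L _]; [lia|].
  rewrite E.
  assert (0 < (x ^ 2) ^ S m) by (apply pow_lt; nra).
  nra.
Qed.
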